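(* Let $\alpha_1,\alpha_2,\beta_1,\beta_2>0$, let $\{X(t):t\geq0\}$ be the continuous-time Markov chain on $\mathbb{Z}$ with alternating rates described in the context, and let $p_{k,n}(t):=P(X(t)=n|X(0)=k)$, $k,n\in\mathbb{Z}$, $t\geq0$. Write $\sigma:=\alpha_1+\alpha_2+\beta_1+\beta_2$, $\delta:=\beta_1+\beta_2-\alpha_1-\alpha_2$, $\rho:=\frac{\alpha_1\beta_1}{\alpha_2\beta_2}$, and let $\vartheta^n_{r,s}$, $\eta^n_{r,s}$ be as in the context. (i) Assume that $\alpha_1+\alpha_2\neq\beta_1+\beta_2$. Then, for all $s,r\in\mathbb{Z}$: $$p_{2r,2s}(t)=e^{-\frac{\sigma}{2}t}\sum_{n=|s-r|}^{+\infty}\rho^{s-r}\left[\frac{t^{2n}}{(2n)!}\left(\frac{\delta}{2}\right)^{2n}+\frac{t^{2n+1}}{(2n+1)!}\left(\frac{\delta}{2}\right)^{2n+1}\right]\vartheta^n_{r,s}(\alpha_1,\alpha_2,\beta_1,\beta_2);$$ $$p_{2r,2s+1}(t)=e^{-\frac{\sigma}{2}t}\left\{\alpha_1\sum_{n=|s-r|}^{+\infty}\frac{t^{2n+1}}{(2n+1)!}\left(\frac{\delta}{2}\right)^{2n}\rho^{s-r}\,\vartheta^n_{r,s}(\alpha_1,\alpha_2,\beta_1,\beta_2)+\alpha_2\sum_{n=|s-r+1|}^{+\infty}\frac{t^{2n+1}}{(2n+1)!}\left(\frac{\delta}{2}\right)^{2n}\rho^{s-r+1}\,\vartheta^n_{r,s+1}(\alpha_1,\alpha_2,\beta_1,\beta_2)\right\};$$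 $$p_{2r+1,2s}(t)=e^{-\frac{\sigma}{2}t}\left\{\beta_2\sum_{n=|s-r|}^{+\infty}\frac{t^{2n+1}}{(2n+1)!}\left(\frac{\delta}{2}\right)^{2n}\rho^{s-r}\,\vartheta^n_{r,s}(\beta_1,\beta_2,\alpha_1,\alpha_2)+\beta_1\sum_{n=|s-r-1|}^{+\infty}\frac{t^{2n+1}}{(2n+1)!}\left(\frac{\delta}{2}\right)^{2n}\rho^{s-r-1}\,\vartheta^n_{r,s-1}(\beta_1,\beta_2,\alpha_1,\alpha_2)\right\};$$ $$p_{2r+1,2s+1}(t)=e^{-\frac{\sigma}{2}t}\sum_{n=|s-r|}^{+\infty}\rho^{s-r}\left[\frac{t^{2n}}{(2n)!}\left(\frac{\delta}{2}\right)^{2n}+\frac{t^{2n+1}}{(2n+1)!}\left(\frac{-\delta}{2}\right)^{2n+1}\right]\vartheta^n_{r,s}(\beta_1,\beta_2,\alpha_1,\alpha_2).$$ (ii) Assume that $\alpha_1+\alpha_2=\beta_1+\beta_2$. Then, for all $s,r\in\mathbb{Z}$: $$p_{2r,2s}(t)=e^{-(\alpha_1+\alpha_2)t}\sum_{n=|s-r|}^{+\infty}\rho^{s-r}\frac{t^{2n}}{(2n)!}\,\eta^n_{r,s}(\alpha_1,\alpha_2,\beta_1,\beta_2);$$ $$p_{2r,2s+1}(t)=e^{-(\alpha_1+\alpha_2)t}\left\{\alpha_1\sum_{n=|s-r|}^{+\infty}\frac{t^{2n+1}}{(2n+1)!}\rho^{s-r}\,\eta^n_{r,s}(\alpha_1,\alpha_2,\beta_1,\beta_2)+\alpha_2\sum_{n=|s-r+1|}^{+\infty}\frac{t^{2n+1}}{(2n+1)!}\rho^{s-r+1}\,\eta^n_{r,s+1}(\alpha_1,\alpha_2,\beta_1,\beta_2)\right\};$$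 $$p_{2r+1,2s}(t)=e^{-(\alpha_1+\alpha_2)t}\left\{\beta_2\sum_{n=|s-r|}^{+\infty}\frac{t^{2n+1}}{(2n+1)!}\rho^{s-r}\,\eta^n_{r,s}(\beta_1,\beta_2,\alpha_1,\alpha_2)+\beta_1\sum_{n=|s-r-1|}^{+\infty}\frac{t^{2n+1}}{(2n+1)!}\rho^{s-r-1}\,\eta^n_{r,s-1}(\beta_1,\beta_2,\alpha_1,\alpha_2)\right\};$$ $$p_{2r+1,2s+1}(t)=e^{-(\alpha_1+\alpha_2)t}\sum_{n=|s-r|}^{+\infty}\frac{t^{2n}}{(2n)!}\rho^{s-r}\,\eta^n_{r,s}(\beta_1,\beta_2,\alpha_1,\alpha_2).$$
   Context: $\{X(t):t\geq 0\}$ is the continuous-time Markov chain on $\mathbb{Z}$ whose state probabilities satisfy $p_{k,n}(0)=1_{\{k=n\}}$ and whose generator $g_{k,n}:=\lim_{t\to 0}\frac{p_{k,n}(t)-p_{k,n}(0)}{t}$ is as follows. For even $k$: $g_{k,k+1}=\alpha_1$, $g_{k,k-1}=\alpha_2$, $g_{k,k}=-(\alpha_1+\alpha_2)$. For odd $k$: $g_{k,k+1}=\beta_1$, $g_{k,k-1}=\beta_2$, $g_{k,k}=-(\beta_1+\beta_2)$. All other entries are $0$. Binomial coefficients with negative arguments are equal to zero (and $\binom{m}{l}=0$ for $l>m\geq0$, as usual). If $\alpha_1+\alpha_2\neq\beta_1+\beta_2$, $$\vartheta^n_{r,s}(\alpha_1,\alpha_2,\beta_1,\beta_2):=\left(\frac{4\alpha_2\beta_2}{(\alpha_1+\alpha_2-\beta_1-\beta_2)^2}\right)^{s-r}\sum_{h=0}^{n-s+r}\binom{n}{h+s-r}\left(\frac{4\alpha_1\beta_2}{(\alpha_1+\alpha_2-\beta_1-\beta_2)^2}\right)^{h}\sum_{l=0}^{h}\binom{h+s-r}{l}\binom{h+s-r}{h-l}\left(\frac{\alpha_2\beta_1}{\alpha_1\beta_2}\right)^{l};$$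 if $\alpha_1+\alpha_2=\beta_1+\beta_2$, $$\eta^n_{r,s}(\alpha_1,\alpha_2,\beta_1,\beta_2):=\left(\frac{\alpha_2}{\alpha_1}\right)^{s-r}(\alpha_1\beta_2)^n\sum_{l=0}^{n-s+r}\binom{n}{l}\binom{n}{s-r+l}\left(\frac{\alpha_2\beta_1}{\alpha_1\beta_2}\right)^{l}.$$ $\vartheta^n_{r,s}(\beta_1,\beta_2,\alpha_1,\alpha_2)$ and $\eta^n_{r,s}(\beta_1,\beta_2,\alpha_1,\alpha_2)$ are obtained by exchanging $\alpha_i\leftrightarrow\beta_i$, $i=1,2$. *)

(* Defs.v *)
From HB Require Import structures.
From mathcomp Require Import all_boot all_order all_algebra.
From mathcomp Require Import all_classical all_reals all_analysis.

Set Implicit Arguments.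
Unset Strict Implicit.
Unset Printing Implicit Defensive.

Import Order.TTheory GRing.Theory Num.Theory.
Import numFieldNormedType.Exports.

Local Open Scope classical_set_scope.
Local Open Scope ring_scope.

(* [P k] is the conditional law P( . | X(0) = k); only times t >= 0 are
   meaningful. *)
Definition trans_prob (d : measure_display) (T : measurableType d)
    (R : realType) (P : int -> probability T R) (X : R -> T -> int)
    (k n : int) (t : R) : R :=
  fine (P k (X t @^-1` [set n])).

(* The event {X(q.1) = q.2 for all q in h}. *)
Definition past_event (T : Type) (R : realType) (X : R -> T -> int)
    (h : seq (R * int)) : set T :=
  [set w | forall q, q \in h -> X q.1 w = q.2].

(* The Markov property is written in product form, which also covers
   conditioning events of probability zero: it says that
   P_k(X(u + t) = n | X(u) = i, past) = P_i(X(t) = n), where the past is any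
   finite list of (time, state) pairs with times in [0, u]. *)
Record markov_chain (d : measure_display) (T : measurableType d)
    (R : realType) (P : int -> probability T R) (X : R -> T -> int) : Prop := {
  state_measurable : forall (t : R) (n : int), 0 <= t ->
    measurable (X t @^-1` [set n]);
  initial_law : forall k n : int,
    trans_prob P X k n 0 = (k == n)%:R;
  markov_property : forall (k i n : int) (h : seq (R * int)) (u t : R),
    0 <= u -> 0 <= t -> (forall q, q \in h -> 0 <= q.1 <= u) ->
    P k (past_event X h `&` X u @^-1` [set i] `&` X (u + t) @^-1` [set n]) =
    (P k (past_event X h `&` X u @^-1` [set i]) * P i (X t @^-1` [set n]))%E
}.

Definition has_generator (R : realType) (p : int -> int -> R -> R)
    (g : int -> int -> R) : Prop :=
  forall k n : int, (fun t : R => (p k n t - p k n 0) / t) @ 0^'+ --> g k n.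

Definition birth_death_row (R : realType) (up down : R) (k n : int) : R :=
  if n == k + 1 then up
  else if n == k - 1 then down
  else if n == k then - (up + down)
  else 0.

Definition alternating_generator (R : realType) (a1 a2 b1 b2 : R)
    (k n : int) : R :=
  if (2 %| k)%Z then birth_death_row a1 a2 k n else birth_death_row b1 b2 k n.

Definition binz (m l : int) : nat :=
  match m, l with
  | Posz m', Posz l' => 'C(m', l')
  | _, _ => 0%N
  end.

(* The sum of F h over 0 <= h <= N, empty when N < 0. *)
Definition sum_upto (R : realType) (N : int) (F : nat -> R) : R :=
  match N with
  | Posz N' => \sum_(0 <= h < N'.+1) F h
  | Negz _ => 0
  end.

Definition theta_coef (R : realType) (a1 a2 b1 b2 : R) (n : nat) (r s : int) : R :=
  (4 * a2 * b2 / (a1 + a2 - b1 - b2) ^+ 2) ^ (s - r) *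
  sum_upto (n%:Z - s + r) (fun h =>
    (binz n (h%:Z + s - r))%:R *
    (4 * a1 * b2 / (a1 + a2 - b1 - b2) ^+ 2) ^+ h *
    \sum_(0 <= l < h.+1)
      (binz (h%:Z + s - r) l)%:R * (binz (h%:Z + s - r) (h%:Z - l%:Z))%:R *
      (a2 * b1 / (a1 * b2)) ^+ l).

Definition eta_coef (R : realType) (a1 a2 b1 b2 : R) (n : nat) (r s : int) : R :=
  (a2 / a1) ^ (s - r) * (a1 * b2) ^+ n *
  sum_upto (n%:Z - s + r) (fun l =>
    (binz n l)%:R * (binz n (s - r + l%:Z))%:R * (a2 * b1 / (a1 * b2)) ^+ l).

(* The series of the u n over n >= N converges, with sum S. *)
Definition sums_to (R : realType) (N : nat) (u : nat -> R) (S : R) : Prop :=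
  (fun M : nat => \sum_(N <= n < M) u n) @ \oo --> S.

(* Main.v *)
Require Import Defs.
From HB Require Import structures.
From mathcomp Require Import all_boot all_order all_algebra.
From mathcomp Require Import all_classical all_reals all_analysis.
From mathcomp Require Import ring lra zify.

(** The rates are bounded, so the Markov property over a short first step gives
    the backward equation p_k' = up_k p_(k+1) + down_k p_(k-1) - (up_k + down_k) p_k
    with an error uniform in time, and v_k := e^(sigma t / 2) p_k solves v' = B v,
    where B is tridiagonal with diagonal +-delta/2.  A bounded solution of such a
    system is the sum of its Taylor series, so v_k(t) = sum_m t^m/m! (B^m 1_x)(k).
    The shift by sigma/2 makes B^2 preserve parity, on which it acts as convolution
    with delta^2/4 + (a1 + a2 z)(b1 + b2 z)/z, the powers of z counting steps of
    length two to the left; hence the entries of B^(2n) are coefficients of the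
    n-th power of this Laurent polynomial, and the binomial theorem turns them into
    theta and eta. *)

Set Implicit Arguments.
Unset Strict Implicit.
Unset Printing Implicit Defensive.

Import Order.TTheory GRing.Theory Num.Theory.
Import numFieldNormedType.Exports.

Local Open Scope classical_set_scope.
Local Open Scope ring_scope.

(** * Short-time behaviour of the chain *)

Section MarkovChain.
Variables (R : realType) (d : measure_display) (T : measurableType d).
Variables (P : int -> probability T R) (X : R -> T -> int).
Hypothesis mcX : markov_chain P X.

Lemma trans_prob_ge0 (k n : int) (t : R) : 0 <= trans_prob P X k n t.
Proof. by rewrite /trans_prob fine_ge0. Qed.

Lemma trans_prob_le1 (k n : int) (t : R) : 0 <= t -> trans_prob P X k n t <= 1.
Proof.
move=> t0; have mX := state_measurable mcX n t0.
by rewrite /trans_prob -lee_fin fineK ?fin_num_measure// probability_le1.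
Qed.

(** The Markov property with an empty list of past observations. *)
Lemma joint_prob (k i n : int) (h t : R) : 0 <= h -> 0 <= t ->
  fine (P k (X h @^-1` [set i] `&` X (h + t) @^-1` [set n])) =
  trans_prob P X k i h * trans_prob P X i n t.
Proof.
move=> h0 t0; have := markov_property mcX k i n (h := [::]) h0 t0.
have -> : past_event X [::] = setT :> set T.
  by apply/seteqP; split=> // w _ q.
have mX := state_measurable mcX.
by rewrite !setTI => -> //; rewrite fineM// fin_num_measure//; apply: mX.
Qed.

(* Staying within one step of k: for small h the complement has probability o(h). *)
Definition near_prob (k : int) (h : R) : R :=
  trans_prob P X k k h + trans_prob P X k (k + 1) h + trans_prob P X k (k - 1) h.

(** The event {X(h + t) = n} is split according to whether X(h) lies in {k, k + 1, k - 1}. The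
    Markov property evaluates the first part exactly; the second is contained in the event that X(h)
    avoids these three states, whose probability [1 - near_prob k h] does not depend on t. *)
Lemma trans_prob_step (k n : int) (h t : R) : 0 <= h -> 0 <= t ->
  0 <= trans_prob P X k n (h + t) -
    (trans_prob P X k k h * trans_prob P X k n t +
     trans_prob P X k (k + 1) h * trans_prob P X (k + 1) n t +
     trans_prob P X k (k - 1) h * trans_prob P X (k - 1) n t) <=
  1 - near_prob k h.
Proof.
move=> h0 t0.
have mX s m : 0 <= s -> measurable (X s @^-1` [set m]).
  exact: (state_measurable mcX).
have ht0 : 0 <= h + t by exact: addr_ge0.
pose E := X (h + t) @^-1` [set n].
pose A i := X h @^-1` [set i].
have mE : measurable E by exact: mX.
have mA i : measurable (A i) by exact: mX.
pose N := A k `|` A (k + 1) `|` A (k - 1).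
have mN : measurable N by do 2?apply: measurableU.
have disj i j : i != j -> A i `&` A j = set0.
  by move=> ij; apply/seteqP; split=> // w [/= e1 e2]; rewrite -e1 -e2 eqxx in ij.
have fineU (B C : set T) : measurable B -> measurable C -> B `&` C = set0 ->
    fine (P k (B `|` C)) = fine (P k B) + fine (P k C).
  by move=> mB mC BC; rewrite measureU// fineD// fin_num_measure.
have k1 : k != k + 1 by lia.
have k2 : k != k - 1 by lia.
have k3 : k + 1 != k - 1 by lia.
have NE : near_prob k h = fine (P k N).
  rewrite /near_prob /trans_prob /N fineU//; last 2 first.
  - exact: measurableU.
  - by rewrite setIUl !disj// setU0.
  by rewrite fineU// disj.
have NEE : fine (P k (N `&` E)) = 
    trans_prob P X k k h * trans_prob P X k n t +
     trans_prob P X k (k + 1) h * trans_prob P X (k + 1) n t +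
     trans_prob P X k (k - 1) h * trans_prob P X (k - 1) n t.
  rewrite -!joint_prob// -/E -!/(A _) /N !setIUl.
  have dI i j : i != j -> (A i `&` E) `&` (A j `&` E) = set0.
    by move=> ij; rewrite setIACA disj// set0I.
  rewrite fineU; last 3 first.
  - by apply: measurableU; exact: measurableI.
  - exact: measurableI.
  - by rewrite setIUl !dI// setU0.
  by rewrite fineU ?dI//; exact: measurableI.
have split_E : trans_prob P X k n (h + t) =
    fine (P k (N `&` E)) + fine (P k (~` N `&` E)).
  rewrite -fineU; last 3 first.
  - exact: measurableI.
  - by apply: measurableI => //; exact: measurableC.
  - by rewrite setIACA setICr set0I.
  by rewrite -setIUl setUCr setTI.
rewrite split_E NEE addrC addKr NE fine_ge0//=.
have -> : 1 - fine (P k N) = fine (P k (~` N)).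
  by rewrite probability_setC// fineB// fin_num_measure.
rewrite fine_le ?fin_num_measure//.
- by apply: measurableI => //; exact: measurableC.
- exact: measurableC.
- apply: le_measure; rewrite ?inE//.
  + by apply: measurableI => //; exact: measurableC.
  + exact: measurableC.
Qed.

End MarkovChain.

(** * From uniform right derivatives to derivatives *)

Section UniformRightDerivative.
Variables (R : realType) (F G e : R -> R).
Hypothesis e0 : e @ 0^'+ --> (0 : R).
Hypothesis rightFG : forall t h, 0 <= t -> 0 < h ->
  `|(F (t + h) - F t) / h - G t| <= e h.

Lemma uniform_right_derivative_dist (C t h : R) : `|G t| <= C ->
  0 <= t -> 0 < h -> `|F (t + h) - F t| <= h * (e h + C).
Proof.
move=> GC t0 h0; rewrite mulrC -ler_pdivrMr// -[X in _ / X]gtr0_norm// -normf_div.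
rewrite -[X in `|X|](subrK (G t)); apply: le_trans (ler_normD _ _) _.
by apply: lerD => //; exact: rightFG.
Qed.

Lemma cvg_right_modulus (C : R) : h * (e h + C) @[h --> 0^'+] --> (0 : R).
Proof.
rewrite -[X in _ --> X](mul0r (0 + C)); apply: cvgM.
  exact: cvg_at_right_filter.
by apply: cvgD => //; exact: cvg_cst.
Qed.

Lemma uniform_right_derivative_cvg_right (C t : R) : `|G t| <= C -> 0 <= t ->
  F x @[x --> t^'+] --> F t.
Proof.
move=> GC t0; apply/cvgrPdist_le => eps eps0.
have /cvgrPdist_le/(_ _ eps0) H := cvg_right_modulus C.
apply/nbhs_right0P; apply: filterS2 H (nbhs_right_gt 0) => h.
rewrite sub0r normrN distrC => H h0.
apply: le_trans (uniform_right_derivative_dist GC t0 h0) _.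
exact: le_trans (ler_norm _) H.
Qed.

(** The increment estimate is applied at the moving base point t - h, which is why the bound on [G]
    is uniform in time. *)
Lemma uniform_right_derivative_cvg_left (C t : R) :
  (forall s, 0 <= s -> `|G s| <= C) -> 0 < t -> F x @[x --> t^'-] --> F t.
Proof.
move=> GC t0; apply/cvgrPdist_le => eps eps0.
have /cvgrPdist_le/(_ _ eps0) H := cvg_right_modulus C.
apply/nbhs_left0P; apply: filterS3 H (nbhs_right_gt 0) (nbhs_right_le t0) => h.
rewrite sub0r normrN => H h0 ht.
have th0 : 0 <= t - h by rewrite subr_ge0.
have := uniform_right_derivative_dist (GC _ th0) th0 h0; rewrite subrK.
by move=> /le_trans; apply; exact: le_trans (ler_norm _) H.
Qed.

(* The error bound is uniform in time, so the right difference quotient taken at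
   t - h also controls the left one at t. *)
Lemma uniform_right_derivative_is_derive (t : R) : 0 < t ->
  G x @[x --> t^'-] --> G t -> is_derive t 1 F (G t).
Proof.
move=> t0 Gt.
suff H : (F (t + h) - F t) / h @[h --> 0^'] --> G t.
  have E : (fun h : R => h^-1 *: ((F \o shift t) (h *: 1) - F t)) =
           (fun h => (F (t + h) - F t) / h).
    by apply/funext => h /=; rewrite [h *: 1]mulr1 [h + t]addrC [_^-1 *: _]mulrC.
  by apply: DeriveDef; [apply/cvg_ex; exists (G t)|apply: cvg_lim]; rewrite ?E.
apply: (@cvg_at_right_left_dnbhs _ R^o).
  apply/cvgrPdist_le => eps eps0.
  move/cvgrPdist_le/(_ _ eps0) : e0 => H.
  apply: filterS2 H (nbhs_right_gt 0) => h; rewrite sub0r normrN => H h0.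
  rewrite distrC.
  apply: le_trans (rightFG (ltW t0) h0) _; exact: le_trans (ler_norm _) H.
apply/cvg_at_leftNP; rewrite oppr0.
have GtN : G (t - h) @[h --> 0^'+] --> G t.
  apply/cvgrPdist_le => eps eps0.
  by move/cvgrPdist_le/(_ _ eps0)/nbhs_left0P : Gt.
apply/cvgrPdist_le => eps eps0.
have eps20 : 0 < eps / 2 by rewrite divr_gt0.
move/cvgrPdist_le/(_ _ eps20) : e0 => H.
move/cvgrPdist_le/(_ _ eps20) : GtN => H'.
apply: (filterS3 _ _ (filterI H H') (nbhs_right_gt 0) (nbhs_right_le t0)).
move=> h [{}H {}H'] h0 ht; rewrite sub0r normrN in H.
have th0 : 0 <= t - h by rewrite subr_ge0.
have := rightFG th0 h0; rewrite subrK => H2.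
rewrite /= invrN mulrN -mulNr opprB.
have := le_trans H2 (le_trans (ler_norm _) H).
rewrite distrC => H3.
have -> : G t - (F t - F (t - h)) / h =
  (G t - G (t - h)) + (G (t - h) - (F t - F (t - h)) / h) by ring.
rewrite [eps]splitr; exact: le_trans (ler_normD _ _) (lerD H' H3).
Qed.

End UniformRightDerivative.

(** * Taylor series of bounded tridiagonal systems *)

Section TridiagonalSystem.
Variable R : realType.

Definition tridiag (c u w : int -> R) (f : int -> R) (k : int) : R :=
  c k * f k + u k * f (k + 1) + w k * f (k - 1).

Definition taylor_sum (b : nat -> R) (N : nat) (t : R) : R :=
  \sum_(0 <= m < N) t ^+ m / m`!%:R * b m.

Lemma is_derive_taylor_term (a : R) (N : nat) (t : R) :
  is_derive t 1 (fun s => s ^+ N.+1 / N.+1`!%:R * a) (t ^+ N / N`!%:R * a).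
Proof.
have -> : (fun s : R => s ^+ N.+1 / N.+1`!%:R * a) =
    (a / N.+1`!%:R) \*: (@id R ^+ N.+1).
  by apply/funext => s; rewrite !fctE/= mulrAC [_ ^+ _ * a]mulrC mulrAC.
have H := is_deriveX N.+1 (is_derive_id t (1 : R)).
apply: (is_derive_eq (is_deriveZ _ H)).
have n0 : (N.+1%:R : R) != 0 by rewrite pnatr_eq0.
have f0 : (N`!%:R : R) != 0 by rewrite pnatr_eq0 -lt0n fact_gt0.
rewrite factS natrM invfM /GRing.scale/= -mulr_natr; field.
by rewrite nat1r n0 f0.
Qed.

Lemma is_derive_taylor_sum (b : nat -> R) (N : nat) (t : R) :
  is_derive t 1 (taylor_sum b N.+1) (taylor_sum (fun m => b m.+1) N t).
Proof.
elim: N => [|N IH].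
  have -> : taylor_sum b 1 = cst (b 0).
    by apply/funext => s; rewrite /taylor_sum big_nat1 expr0 fact0 divr1 mul1r.
  by rewrite /taylor_sum big_geq//; exact: is_derive_cst.
have -> : taylor_sum b N.+2 = taylor_sum b N.+1 +
    (fun s => s ^+ N.+1 / N.+1`!%:R * b N.+1).
  by apply/funext => s; rewrite /taylor_sum big_nat_recr.
rewrite [X in is_derive _ _ _ X]/taylor_sum big_nat_recr//=.
by apply: is_deriveD; exact: is_derive_taylor_term.
Qed.

Variables (c u w : int -> R) (C : R).
Hypothesis bounded_coef : forall k, `|c k| + `|u k| + `|w k| <= C.

Local Notation B := (tridiag c u w).

(** The constant [C] dominates the norm of [B] on bounded functions with the supremum norm. *)
Lemma tridiag_bound (f : int -> R) (M : R) (k : int) :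
  (forall i, `|f i| <= M) -> `|B f k| <= C * M.
Proof.
move=> fM; have M0 : 0 <= M := le_trans (normr_ge0 _) (fM 0).
apply: le_trans (ler_wpM2r M0 (bounded_coef k)).
rewrite /tridiag !mulrDl; apply: le_trans (ler_normD _ _) _.
rewrite lerD//; first apply: le_trans (ler_normD _ _) _; first apply: lerD.
all: by rewrite normrM ler_wpM2l.
Qed.

Lemma tridiagB (f g : int -> R) (k : int) :
  B (fun i => f i - g i) k = B f k - B g k.
Proof. by rewrite /tridiag; ring. Qed.

Lemma tridiag_taylor_sum (b : nat -> int -> R) (N : nat) (t : R) (k : int) :
  B (fun i => taylor_sum (fun m => b m i) N t) k =
  taylor_sum (fun m => B (b m) k) N t.
Proof.
rewrite /tridiag /taylor_sum !mulr_sumr -!big_split/=.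
by apply: eq_bigr => m _; ring.
Qed.

Variables (v : int -> R -> R) (T M : R).
Hypothesis T0 : 0 < T.
Hypothesis v_cont : forall k, {within `[0, T], continuous (v k)}.
Hypothesis v_derive : forall k t, t \in `]0, T[%R ->
  is_derive t 1 (v k) (B (v ^~ t) k).
Hypothesis v_bounded : forall k t, t \in `[0, T]%R -> `|v k t| <= M.

Let S N k t := taylor_sum (fun m => iter m B (v ^~ 0) k) N t.

Lemma continuous_taylor_sum b N : continuous (taylor_sum b N).
Proof.
case: N => [|N] t.
  have -> : taylor_sum b 0 = cst 0.
    by apply/funext => s; rewrite /taylor_sum big_geq.
  exact: cst_continuous.
apply: differentiable_continuous; apply/derivable1_diffP.
by have [] := is_derive_taylor_sum b N t.
Qed.

(** The difference [G - g] has a nonnegative derivative inside the interval, hence is nondecreasing.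
    This replaces integration of derivative bounds. *)
Lemma derive_dominated (g G dg dG : R -> R) :
  {within `[0, T], continuous g} -> {within `[0, T], continuous G} ->
  (forall t, t \in `]0, T[%R -> is_derive t 1 g (dg t)) ->
  (forall t, t \in `]0, T[%R -> is_derive t 1 G (dG t)) ->
  (forall t, t \in `]0, T[%R -> dg t <= dG t) -> g 0 <= G 0 ->
  forall t, t \in `[0, T]%R -> g t <= G t.
Proof.
move=> cg cG Dg DG dgG gG0 t tT.
have D s : s \in `]0, T[%R -> is_derive s 1 (G - g) (dG s - dg s).
  by move=> sT; apply: is_deriveB; [exact: DG|exact: Dg].
have h0 : 0 \in `[0, T]%R by rewrite in_itv/= lexx ltW.
have tT0 : 0 <= t by move: tT; rewrite in_itv/= => /andP[].
have : (G - g) 0 <= (G - g) t.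
  apply: (@ger0_derive1_le_cc _ (G - g) 0 T) => //.
  - by move=> s /D [].
  - by move=> s sT; have [_ Ds] := D s sT; rewrite derive1E Ds subr_ge0 dgG.
  - by apply: within_continuousB.
by rewrite !fctE => H; rewrite -subr_ge0 (le_trans _ H)// subr_ge0.
Qed.

(** Induction on [N], for all states at once because [B] mixes neighbours: the derivative of
    [v - S N.+1] is [B (v - S N)], which is at most [C] times the bound of rank [N], and the bound
    of rank [N.+1] is an antiderivative of that. *)
Lemma tridiag_taylor (N : nat) (k : int) (t : R) : t \in `[0, T]%R ->
  `|v k t - S N k t| <= t ^+ N / N`!%:R * (M * C ^+ N).
Proof.
elim: N k t => [|N IH] k t tT.
  by rewrite /S /taylor_sum big_geq// subr0 expr0 fact0 divr1 mul1r mulr1 v_bounded.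
have DR s : s \in `]0, T[%R ->
    is_derive s 1 (v k - S N.+1 k) (B (fun i => v i s - S N i s) k).
  move=> sT; rewrite tridiagB tridiag_taylor_sum.
  apply: is_deriveB; first exact: v_derive.
  exact: is_derive_taylor_sum.
pose G s := s ^+ N.+1 / N.+1`!%:R * (M * C ^+ N.+1).
have DG (s : R) : is_derive s 1 G (s ^+ N / N`!%:R * (M * C ^+ N.+1)).
  exact: is_derive_taylor_term.
have cG : {within `[0, T], continuous G}.
  apply: continuous_subspaceT => s; apply: differentiable_continuous.
  by apply/derivable1_diffP; have [] := DG s.
have cv : {within `[0, T], continuous (v k - S N.+1 k)}.
  apply: within_continuousB => //.
  by apply: continuous_subspaceT; exact: continuous_taylor_sum.
have bd s : s \in `]0, T[%R ->
    `|B (fun i => v i s - S N i s) k| <= s ^+ N / N`!%:R * (M * C ^+ N.+1).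
  move=> sT; have -> : s ^+ N / N`!%:R * (M * C ^+ N.+1) =
      C * (s ^+ N / N`!%:R * (M * C ^+ N)) by rewrite exprS; ring.
  apply: tridiag_bound => i.
  by apply: IH; apply: subset_itv_oo_cc.
(* At time 0 only the term m = 0 of the Taylor sum survives, and it equals [v k 0]. *)
have z0 : (v k - S N.+1 k) 0 = 0.
  rewrite !fctE /S /taylor_sum big_nat_recl//= expr0 fact0 divr1 mul1r.
  rewrite big1 ?addr0 ?subrr// => m _.
  by rewrite expr0n/= mul0r mul0r.
have G0 : G 0 = 0 by rewrite /G expr0n/= !mul0r.
(* The absolute value is bounded by two comparisons, with [G] from above and [- G] from below. *)
rewrite ler_norml; apply/andP; split; last first.
  apply: (derive_dominated cv cG DR (fun s _ => DG s)) => //.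
    by move=> s /bd; rewrite ler_norml => /andP[].
  by rewrite z0 G0.
apply: (@derive_dominated (- G) (v k - S N.+1 k)
  (fun s => - (s ^+ N / N`!%:R * (M * C ^+ N.+1))) _ _ cv) => //.
- apply: continuous_subspaceT => s; apply: differentiable_continuous.
  by apply/derivable1_diffP; have [] := is_deriveN (DG s).
- by move=> s /bd; rewrite ler_norml => /andP[].
- by rewrite z0 !fctE G0 oppr0.
Qed.

Lemma tridiag_series (k : int) (t : R) : t \in `[0, T]%R ->
  (fun N => S N k t) @ \oo --> v k t.
Proof.
move=> tT; apply/subr_cvg0.
(* Up to the factor [M], the remainder bound is the general term of the exponential series at
   [t * C]. *)
have tend0 : (fun N => exp_coeff (t * C) N * M) @ \oo --> (0 : R).
  rewrite -[X in _ --> X](mul0r M); apply: cvgM; last exact: cvg_cst.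
  exact: cvg_exp_coeff.
apply/norm_cvg0P; apply: (squeeze_cvgr _ (cvg_cst 0) tend0).
apply: nearW => N; rewrite normr_ge0/= distrC.
apply: le_trans (tridiag_taylor N k tT) _.
by rewrite /exp_coeff/= exprMn le_eqVlt; apply/orP; left; apply/eqP; ring.
Qed.

End TridiagonalSystem.

(** * Powers of the two-step operator *)

Section StepCoefficients.
Variable R : realType.
Implicit Types (p q : {poly R}) (D x y : R).

(** Integer exponents, with value 0 at negative ones, let the recurrences below hold without
    boundary cases. *)
Definition coefz p (i : int) : R := if i is Posz n then p`_n else 0.

Lemma coefzD p q i : coefz (p + q) i = coefz p i + coefz q i.
Proof. by case: i => n /=; rewrite ?coefD ?addr0. Qed.

Lemma coefzZ x p i : coefz (x *: p) i = x * coefz p i.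
Proof. by case: i => n /=; rewrite ?coefZ ?mulr0. Qed.

Lemma coefzXM p i : coefz ('X * p) i = coefz p (i - 1).
Proof.
case: i => [[|n]|n].
- by rewrite /= coefXM.
- by rewrite (_ : n.+1%:Z - 1 = n) ?[LHS]coefXM//; lia.
- by rewrite (_ : Negz n - 1 = Negz n.+1)//; lia.
Qed.

Lemma coefzXnM p k i : coefz ('X^k * p) i = coefz p (i - k%:Z).
Proof.
elim: k i => [|k IH] i; first by rewrite expr0 mul1r subr0.
by rewrite exprS -mulrA coefzXM IH -addn1 PoszD opprD addrA addrAC.
Qed.

Lemma coefz_sum (I : Type) (r : seq I) (F : I -> {poly R}) i :
  coefz (\sum_(k <- r) F k) i = \sum_(k <- r) coefz (F k) i.
Proof.
elim: r => [|k r IH]; last by rewrite !big_cons coefzD IH.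
by rewrite !big_nil; case: i => n //=; rewrite coef0.
Qed.

Lemma coef_linear_exp x y m l :
  ((x%:P + y *: 'X) ^+ m)`_l = x ^+ (m - l) * y ^+ l * 'C(m, l)%:R.
Proof.
rewrite exprDn.
have -> : \sum_(i < m.+1) (x%:P) ^+ (m - i) * (y *: 'X) ^+ i *+ 'C(m, i) =
    \poly_(i < m.+1) (x ^+ (m - i) * y ^+ i * 'C(m, i)%:R).
  rewrite poly_def; apply: eq_bigr => i _.
  by rewrite exprZn -polyC_exp mul_polyC scalerA scalerMnl mulr_natr.
rewrite coef_poly; case: ltnP => // ml.
by rewrite bin_small// mulr0.
Qed.

Lemma eq_sum_upto (N : int) (F G : nat -> R) :
  (forall h : nat, h%:Z <= N -> F h = G h) -> sum_upto N F = sum_upto N G.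
Proof.
case: N => [N|//] FG /=; apply: eq_big_nat => h; rewrite ltnS => /= hN.
by apply: FG; rewrite lez_nat.
Qed.

Lemma mulr_sum_upto x (N : int) (F : nat -> R) :
  x * sum_upto N F = sum_upto N (fun h => x * F h).
Proof. by case: N => [N|N] /=; rewrite ?mulr0// mulr_sumr. Qed.

(** Reindexing by m = h + j. For j >= 0 the right-hand side has extra indices below j, for j < 0 the
    left-hand side has extra negative ones; each vanishing hypothesis removes one kind. *)
Lemma sum_upto_shift (n : nat) (j : int) (F : int -> R) :
  (forall i, i < 0 -> F i = 0) -> (forall i, i < j -> F i = 0) ->
  sum_upto (n%:Z - j) (fun h => F (h%:Z + j)) = \sum_(0 <= m < n.+1) F m%:Z.
Proof.
move=> F0 Fj; case: j Fj => j Fj.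
  have [jn|nj] := leqP j n.
    rewrite subzn// /= [RHS](@big_cat_nat _ _ _ j)//=; last by rewrite ltnW.
    have -> : \sum_(0 <= m < j) F m%:Z = 0.
      by rewrite big_nat big1// => i /andP[_ ij]; apply: Fj; rewrite ltz_nat.
    rewrite add0r.
    rewrite -[X in _ = \sum_(X <= _ < _) _]add0n big_addn subSn//.
  have [k ->] : exists k, n%:Z - j%:Z = Negz k by exists (j - n).-1; clear -nj; lia.
  rewrite /= big_nat big1// => i /andP[_ ij]; apply: Fj.
  by rewrite ltz_nat (leq_trans _ nj)//.
have -> : n%:Z - Negz j = (j.+1 + n)%N by lia.
rewrite /= -addnS (@big_cat_nat _ _ _ j.+1)//= ?leq_addr//.
have -> : \sum_(0 <= h < j.+1) F (h%:Z + Negz j) = 0.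
  by rewrite big_nat big1// => i /andP[_ ij]; apply: F0; lia.
rewrite add0r.
rewrite -[X in \sum_(X <= _ < _) _]add0n big_addn addKn.
by apply: eq_bigr => i _; congr F; lia.
Qed.

Lemma binz_sub (m : nat) (i : int) : binz m i = binz m (m%:Z - i).
Proof.
case: i => i.
  have [im|mi] := leqP i m; first by rewrite subzn//= bin_sub.
  have [k ->] : exists k, m%:Z - i%:Z = Negz k by exists (i - m).-1; clear -mi; lia.
  by rewrite /= bin_small.
have -> : m%:Z - Negz i = (m + i.+1)%N by lia.
by rewrite /= bin_small// addnS ltnS leq_addr.
Qed.

Variables (a1 a2 b1 b2 : R).

(** Each factor encodes one jump, from an even and from an odd state, with ['X] marking a jump to
    the left. Divided by z, this is the Laurent polynomial of two consecutive jumps. *)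
Definition step_poly := (a1%:P + a2 *: 'X) * (b1%:P + b2 *: 'X).

(* The coefficient of z^(- j) in (D + step_poly / z)^n. *)
Definition step_coef D (n : nat) (j : int) :=
  coefz ((D *: 'X + step_poly) ^+ n) (n%:Z - j).

Lemma step_coef0 D j : step_coef D 0 j = (j == 0)%:R.
Proof.
by rewrite /step_coef sub0r expr0; case: j => [[|j]|j] //=; rewrite coef1.
Qed.

(** Expanding one factor gives the same three-term recurrence as two applications of the tridiagonal
    operator. *)
Lemma step_coefS D n j : step_coef D n.+1 j =
  (D + a1 * b2 + a2 * b1) * step_coef D n j +
  a1 * b1 * step_coef D n (j - 1) + a2 * b2 * step_coef D n (j + 1).
Proof.
rewrite /step_coef exprS; set q := _ ^+ n.
have -> : (D *: 'X + step_poly) * q =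
    (D + a1 * b2 + a2 * b1) *: ('X * q) + (a1 * b1) *: q +
    (a2 * b2) *: ('X * ('X * q)).
  by rewrite /step_poly -!mul_polyC !polyCD !polyCM; ring.
rewrite !coefzD !coefzZ !coefzXM.
by congr (_ * coefz _ _ + _ * coefz _ _ + _ * coefz _ _); lia.
Qed.

(** Each factor shifts the exponent by at most one. This is why the series start at n = |s - r|. *)
Lemma step_coef_eq0 D n j : (n < `|j|)%N -> step_coef D n j = 0.
Proof.
elim: n j => [|n IH] j nj.
  by rewrite step_coef0; case: eqP => // j0; rewrite j0 in nj.
by rewrite step_coefS !IH ?mulr0 ?addr0//; lia.
Qed.

(** Nonnegativity is what later permits splitting one convergent series into two. *)
Lemma step_coef_ge0 D n j : 0 <= D -> 0 <= a1 -> 0 <= a2 -> 0 <= b1 -> 0 <= b2 ->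
  0 <= step_coef D n j.
Proof.
move=> D0 a10 a20 b10 b20; elim: n j => [|n IH] j; first by rewrite step_coef0.
by rewrite step_coefS !addr_ge0// !mulr_ge0// !addr_ge0// mulr_ge0.
Qed.

(** Binomial theorem, with m counting the factors where [step_poly] is chosen; the other n - m
    factors contribute [D *: 'X], which lowers the exponent n - j to m - j. *)
Lemma step_coefE D n j : step_coef D n j =
  \sum_(0 <= m < n.+1)
    'C(n, m)%:R * D ^+ (n - m) * coefz (step_poly ^+ m) (m%:Z - j).
Proof.
rewrite /step_coef exprDn coefz_sum big_mkord; apply: eq_bigr => i _.
rewrite exprZn -scalerAl scalerMnl coefzZ -mulr_natr.
rewrite coefzXnM [_ * 'C(_, _)%:R]mulrC; congr (_ * coefz _ _).
by have := ltn_ord i; lia.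
Qed.

End StepCoefficients.

(** * Closed forms of the coefficients: [theta_coef] and [eta_coef] *)

Section ClosedForms.
Variable R : realType.
Variables (a1 a2 b1 b2 : R).
Hypotheses (a1_neq0 : a1 != 0) (a2_neq0 : a2 != 0).
Hypotheses (b1_neq0 : b1 != 0) (b2_neq0 : b2 != 0).

Local Notation P := (step_poly a1 a2 b1 b2).
Local Notation rho := (a1 * b1 / (a2 * b2)).

(** The sum over l common to both closed forms: with h = m - j it is the inner sum of [theta_coef],
    and by symmetry of the binomials the sum in [eta_coef]. *)
Definition step_sum (m : nat) (j : int) : R :=
  sum_upto (m%:Z - j) (fun l =>
    (binz m l)%:R * (binz m (m%:Z - j - l%:Z))%:R * (a2 * b1 / (a1 * b2)) ^+ l).

(** Cauchy product of two binomial expansions, with the factors independent of l taken out. *)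
Lemma coefz_step_poly_exp (m : nat) (j : int) :
  coefz (P ^+ m) (m%:Z - j) = (b1 / b2) ^ j * (a1 * b2) ^+ m * step_sum m j.
Proof.
rewrite /step_sum mulr_sum_upto; case E : (m%:Z - j) => [N|//] /=.
rewrite exprMn coefM big_mkord; apply: eq_bigr => l _.
have lN : (l <= N)%N by rewrite -ltnS.
rewrite !coef_linear_exp subzn//=.
set x := (N - l)%N; have [lm|ml] := leqP l m; last by rewrite bin_small// !(mul0r, mulr0).
have [xm|mx] := leqP x m; last by rewrite (bin_small mx) !(mul0r, mulr0).
(* Writing m = u + l = w + x removes the truncated subtractions and gives j = w - l, so that [field]
   can compare the powers. *)
have [u mE] : exists u, m = (u + l)%N by exists (m - l)%N; rewrite subnK.
have [w mE'] : exists w, m = (w + x)%N by exists (m - x)%N; rewrite subnK.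
have jE : j = w%:Z - l%:Z by rewrite /x in mE'; lia.
have -> : (b1 / b2) ^ j = (b1 / b2) ^+ w / (b1 / b2) ^+ l.
  by rewrite jE expfzDr ?mulf_neq0 ?invr_neq0// exprnN.
have -> : (a1 * b2) ^+ m = a1 ^+ (u + l) * b2 ^+ (w + x).
  by rewrite exprMn {1}mE mE'.
rewrite {1}mE {2}mE' !addnK !expr_div_n !exprMn !exprD invfM invrK.
field.
by rewrite !expf_neq0.
Qed.

(** With D = 0 only pure powers of [step_poly] remain, and [rho * (a2 / a1) = b1 / b2] matches the
    prefactors. *)
Lemma eta_coefE (n : nat) (r s : int) :
  rho ^ (s - r) * eta_coef a1 a2 b1 b2 n r s = step_coef a1 a2 b1 b2 0 n (s - r).
Proof.
rewrite /step_coef scale0r add0r coefz_step_poly_exp /eta_coef !mulrA.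
rewrite -expfzMl.
have -> : rho * (a2 / a1) = b1 / b2.
  by field; rewrite a1_neq0 a2_neq0 b2_neq0.
congr (_ * _).
rewrite /step_sum opprB addrA (addrAC _ r) ; apply: eq_sum_upto => l _.
rewrite (binz_sub n (s - r + _)); congr (_ * (binz _ _)%:R * _); lia.
Qed.

(** The hypothesis fixes [delta] only up to sign, so the lemma applies both to the given rates and
    to the exchanged ones. The outer index h of [theta_coef] is m - j, for m as in [step_coefE]. *)
Lemma theta_coefE (delta : R) (n : nat) (r s : int) :
  delta ^+ 2 = (a1 + a2 - b1 - b2) ^+ 2 -> delta != 0 ->
  (delta / 2) ^+ (2 * n) * rho ^ (s - r) * theta_coef a1 a2 b1 b2 n r s =
  step_coef a1 a2 b1 b2 ((delta / 2) ^+ 2) n (s - r).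
Proof.
move=> deltaE delta0; set D := (delta / 2) ^+ 2; set j := s - r.
have D0 : D != 0 by rewrite expf_neq0// mulf_neq0// invr_neq0// pnatr_eq0.
rewrite step_coefE.
(* The value 0 at negative indices agrees with the convention on binomial coefficients and allows
   the reindexing for either sign of j. *)
pose F (i : int) : R := if i is Posz m then
  'C(n, m)%:R * D ^+ (n - m) * coefz (P ^+ m) (m%:Z - j) else 0.
rewrite -[RHS]/(\sum_(0 <= m < n.+1) F m%:Z) -(sum_upto_shift _ (j := j)); last 2 first.
- by case.
- case=> [m|//] mj; rewrite /F.
  have [k ->] : exists k, m%:Z - j = Negz k by exists (absz (m%:Z - j)).-1; lia.
  by rewrite mulr0.
rewrite /theta_coef !mulr_sum_upto -/j.
rewrite (_ : n%:Z - s + r = n%:Z - j); last by rewrite /j; ring.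
apply: eq_sum_upto => h hn.
rewrite (_ : h%:Z + s - r = h%:Z + j); last by rewrite /j; ring.
case E : (h%:Z + j) => [m|m]; last by rewrite /= !(mul0r, mulr0).
have mn : (m <= n)%N by lia.
rewrite [F _]/F coefz_step_poly_exp /step_sum.
have -> : m%:Z - j = h by lia.
have -> : (a1 + a2 - b1 - b2) ^+ 2 = 4 * D.
  by rewrite -deltaE /D; field.
rewrite exprM -/D.
have -> : 4 * a2 * b2 / (4 * D) = a2 * b2 / D by field.
have -> : 4 * a1 * b2 / (4 * D) = a1 * b2 / D by field.
rewrite !mulrA; congr (_ * _).
have -> : (a1 * b2) ^+ m = (a1 * b2) ^+ h * (a1 * b2) ^ j.
  by rewrite [X in _ = X * _]exprnP -expfzDr ?mulf_neq0// E.
have -> : D ^+ n = D ^+ (n - m) * (D ^+ h * D ^ j).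
  by rewrite [D ^+ h]exprnP -expfzDr// E -exprnP -exprD subnK.
(* All powers with the possibly negative exponent j are merged; both bases equal [a1 * b1]. *)
have E1 : rho ^ j * (a2 * b2 / D) ^ j * D ^ j = (b1 / b2) ^ j * (a1 * b2) ^ j.
  by rewrite -!expfzMl; congr (_ ^ _); field; rewrite D0 a2_neq0 b2_neq0.
have Dh : D ^+ h != 0 by rewrite expf_neq0.
rewrite [binz n m]/= expr_div_n.
transitivity ('C(n, m)%:R * D ^+ (n - m) * (a1 * b2) ^+ h *
    (rho ^ j * (a2 * b2 / D) ^ j * D ^ j)); last by rewrite E1; ring.
move: (rho ^ j) (_ ^ j) (D ^ j) (D ^+ (n - m)) (D ^+ h) Dh => *.
by field.
Qed.

End ClosedForms.

(** * The backward equation *)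

Section AlternatingRates.
Variable R : realType.

Definition alternate (x y : R) (k : int) : R := if (2 %| k)%Z then x else y.

Lemma alternateD1 x y k : alternate x y (k + 1) = alternate y x k.
Proof. by rewrite /alternate; case: ifP; case: ifP => //; lia. Qed.

Lemma alternateB1 x y k : alternate x y (k - 1) = alternate y x k.
Proof. by rewrite /alternate; case: ifP; case: ifP => //; lia. Qed.

Lemma alternate_even x y r : alternate x y (2 * r) = x.
Proof. by rewrite /alternate ifT//; lia. Qed.

Lemma alternate_odd x y r : alternate x y (2 * r + 1) = y.
Proof. by rewrite /alternate ifF//; lia. Qed.

Variables (a1 a2 b1 b2 gamma : R).

Local Notation B := (tridiag (alternate gamma (- gamma))
  (alternate a1 b1) (alternate a2 b2)).
Local Notation coef := (step_coef a1 a2 b1 b2 (gamma ^+ 2)).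

Definition point_mass (x k : int) : R := (k == x)%:R.

(** Neighbouring diagonal entries are opposite, so the contributions of [f (k + 1)] and [f (k - 1)]
    cancel. What remains has the same coefficients at even and odd states. *)
Lemma tridiag_tridiag (f : int -> R) (k : int) : B (B f) k =
  (gamma ^+ 2 + a1 * b2 + a2 * b1) * f k + a1 * b1 * f (k + 2) +
  a2 * b2 * f (k - 2).
Proof.
rewrite {1}/tridiag /tridiag !alternateD1 !alternateB1 addrK subrK.
rewrite -[k + 1 + 1]addrA -[k - 1 - 1]addrA -opprD.
by rewrite /alternate; case: ifP => _; ring.
Qed.

(** Moving k by +2 or -2 changes j by -1 or +1, so [tridiag_tridiag] becomes the recurrence
    [step_coefS]. *)
Lemma iter_tridiag_even (n : nat) (x j : int) :
  iter (2 * n) B (point_mass x) (x - 2 * j) = coef n j.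
Proof.
elim: n j => [|n IH] j.
  rewrite step_coef0 /= /point_mass; congr (_%:R); lia.
rewrite mulnS iterD /= tridiag_tridiag step_coefS IH.
rewrite (_ : x - 2 * j + 2 = x - 2 * (j - 1)); last by ring.
rewrite (_ : x - 2 * j - 2 = x - 2 * (j + 1)); last by ring.
by rewrite !IH.
Qed.

Lemma iter_tridiag_even0 (n : nat) (x j : int) :
  iter (2 * n) B (point_mass x) (x - 2 * j - 1) = 0.
Proof.
elim: n j => [|n IH] j.
  rewrite /= /point_mass; case: eqP => //; lia.
rewrite mulnS iterD /= tridiag_tridiag IH.
rewrite (_ : x - 2 * j - 1 + 2 = x - 2 * (j - 1) - 1); last by ring.
rewrite (_ : x - 2 * j - 1 - 2 = x - 2 * (j + 1) - 1); last by ring.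
by rewrite !IH !mulr0 !addr0.
Qed.

(** The extra application of [B] starts at a state of parity opposite to x, hence the exchanged
    arguments of [alternate]; a jump up leads to x - 2j, a jump down to x - 2(j + 1). *)
Lemma iter_tridiag_odd (n : nat) (x j : int) :
  iter (2 * n + 1) B (point_mass x) (x - 2 * j - 1) =
  alternate b1 a1 x * coef n j + alternate b2 a2 x * coef n (j + 1).
Proof.
rewrite addn1 iterS {1}/tridiag iter_tridiag_even0 mulr0 add0r subrK.
rewrite iter_tridiag_even (_ : x - 2 * j - 1 - 1 = x - 2 * (j + 1)); last by ring.
rewrite iter_tridiag_even; congr (_ * _ + _ * _).
  by rewrite /alternate; case: ifP; case: ifP => //; lia.
by rewrite /alternate; case: ifP; case: ifP => //; lia.
Qed.

(** Both neighbours have the wrong parity and contribute 0, so only the diagonal entry acts. *)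
Lemma iter_tridiag_odd_diag (n : nat) (x j : int) :
  iter (2 * n + 1) B (point_mass x) (x - 2 * j) =
  alternate gamma (- gamma) x * coef n j.
Proof.
rewrite addn1 iterS {1}/tridiag iter_tridiag_even iter_tridiag_even0 mulr0 addr0.
rewrite (_ : x - 2 * j + 1 = x - 2 * (j - 1) - 1); last by ring.
rewrite iter_tridiag_even0 mulr0 addr0; congr (_ * _).
by rewrite /alternate; case: ifP; case: ifP => //; lia.
Qed.

Lemma taylor_sum_double (b : nat -> R) (M : nat) (t : R) :
  taylor_sum b (2 * M) t = \sum_(0 <= n < M)
    (t ^+ (2 * n) / (2 * n)`!%:R * b (2 * n)%N +
     t ^+ (2 * n + 1) / (2 * n + 1)`!%:R * b (2 * n + 1)%N).
Proof.
elim: M => [|M IH]; first by rewrite /taylor_sum !big_geq.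
rewrite [RHS]big_nat_recr//= -IH /taylor_sum mulnS add2n !big_nat_recr//= addn1.
by rewrite addrA.
Qed.

End AlternatingRates.

(** * The chain as a bounded solution of the tridiagonal system *)

Section BackwardEquation.
Variables (R : realType) (d : measure_display) (T : measurableType d).
Variables (P : int -> probability T R) (X : R -> T -> int).
Hypothesis mcX : markov_chain P X.
Variables (a1 a2 b1 b2 : R).
Hypothesis genX :
  has_generator (trans_prob P X) (alternating_generator a1 a2 b1 b2).

Local Notation p := (trans_prob P X).
Local Notation up := (alternate a1 b1).
Local Notation down := (alternate a2 b2).

Let q k n (h : R) : R := (p k n h - p k n 0) / h.

Definition backward_rhs (n k : int) (t : R) : R :=
  up k * p (k + 1) n t + down k * p (k - 1) n t - (up k + down k) * p k n t.

(** Three errors of the difference quotients, then the probability of being outside {k, k + 1, k -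
    1} at time h, divided by h: since p_kk(0) = 1, the last sum is [- (1 - near_prob P X k h) / h].
    It tends to 0 because the generator row sums to 0. *)
Definition backward_err (k : int) (h : R) : R :=
  `|q k k h + (up k + down k)| + `|q k (k + 1) h - up k| +
  `|q k (k - 1) h - down k| + `|q k k h + q k (k + 1) h + q k (k - 1) h|.

Lemma cvg_backward_err k : backward_err k @ 0^'+ --> (0 : R).
Proof.
have q0 : q k k @ 0^'+ --> - (up k + down k).
  have := @genX k k; rewrite /alternating_generator /birth_death_row /alternate.
  by case: ifP => _; do 2![case: eqP; first lia]; rewrite eqxx.
have q1 : q k (k + 1) @ 0^'+ --> up k.
  have := @genX k (k + 1); rewrite /alternating_generator /birth_death_row /alternate.
  by rewrite eqxx.
have q2 : q k (k - 1) @ 0^'+ --> down k.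
  have := @genX k (k - 1); rewrite /alternating_generator /birth_death_row /alternate.
  by rewrite eqxx; case: eqP => //; lia.
have z (f : R -> R) (l : R) : f @ 0^'+ --> l -> `|f h - l| @[h --> 0^'+] --> (0 : R).
  by move=> fl; apply/norm_cvg0P; apply/subr_cvg0.
rewrite -[X in _ --> X]addr0 -{1}[X in _ --> X + _]addr0 -{1}[X in _ --> X + _ + _]addr0.
apply: cvgD; first apply: cvgD; first apply: cvgD.
- by have := z _ _ q0; under eq_fun do rewrite opprK.
- exact: z.
- exact: z.
- have H : q k k h + q k (k + 1) h + q k (k - 1) h @[h --> 0^'+] --> (0 : R).
    rewrite [X in _ --> X](_ : _ = - (up k + down k) + up k + down k); last by ring.
    by apply: cvgD => //; apply: cvgD.
  by have := z _ _ H; under eq_fun do rewrite subr0.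
Qed.

(** Every error of a quotient is multiplied by a transition probability, at most 1, so the total
    bound does not depend on t. *)
Lemma backward_step n k t h : 0 <= t -> 0 < h ->
  `|(p k n (t + h) - p k n t) / h - backward_rhs n k t| <= backward_err k h.
Proof.
move=> t0 h0; rewrite [t + h]addrC.
pose r := p k n (h + t) - (p k k h * p k n t + p k (k + 1) h * p (k + 1) n t +
  p k (k - 1) h * p (k - 1) n t).
have /andP[r0 r1] : 0 <= r <= 1 - near_prob P X k h.
  have H := trans_prob_step mcX k n (ltW h0) t0.
  by rewrite /r; exact: H.
have p0 i j : p i j 0 = (i == j)%:R := initial_law mcX i j.
have k1 : (k == k + 1) = false by lia.
have k2 : (k == k - 1) = false by lia.
have pn1 i : `|p i n t| <= 1.
  by rewrite ger0_norm ?trans_prob_ge0// (trans_prob_le1 mcX).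
have -> : (p k n (h + t) - p k n t) / h - backward_rhs n k t =
  (q k k h + (up k + down k)) * p k n t +
  (q k (k + 1) h - up k) * p (k + 1) n t +
  (q k (k - 1) h - down k) * p (k - 1) n t + r / h.
  by rewrite /r /q !p0 eqxx k1 k2 /backward_rhs /=; field; rewrite gt_eqF.
have rE : `|r / h| <= `|q k k h + q k (k + 1) h + q k (k - 1) h|.
  rewrite ger0_norm ?divr_ge0 ?(ltW h0)// -normrN; apply: le_trans (ler_norm _).
  rewrite ler_pdivrMr//; apply: le_trans r1 _; rewrite le_eqVlt; apply/orP; left.
  by apply/eqP; rewrite /near_prob /q !p0 eqxx k1 k2 /=; field; rewrite gt_eqF.
rewrite /backward_err.
apply: le_trans (ler_normD _ _) (lerD _ rE).
apply: le_trans (ler_normD _ _) (lerD _ _); last by rewrite normrM ler_piMr.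
apply: le_trans (ler_normD _ _) (lerD _ _); by rewrite normrM ler_piMr.
Qed.

Lemma backward_rhs_bounded n k t : 0 <= t ->
  `|backward_rhs n k t| <= `|up k| + `|down k| + `|up k + down k|.
Proof.
move=> t0; have pn1 i : `|p i n t| <= 1.
  by rewrite ger0_norm ?trans_prob_ge0// (trans_prob_le1 mcX).
apply: le_trans (ler_normB _ _) (lerD _ _); last by rewrite normrM ler_piMr.
by apply: le_trans (ler_normD _ _) (lerD _ _); rewrite normrM ler_piMr.
Qed.

Lemma trans_prob_cvg_right n k t : 0 <= t -> p k n x @[x --> t^'+] --> p k n t.
Proof.
move=> t0; exact: (uniform_right_derivative_cvg_right (@cvg_backward_err k)
  (@backward_step n k) (backward_rhs_bounded n k t0)).
Qed.

Lemma trans_prob_cvg_left n k t : 0 < t -> p k n x @[x --> t^'-] --> p k n t.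
Proof.
exact: (uniform_right_derivative_cvg_left (@cvg_backward_err k)
  (@backward_step n k) (@backward_rhs_bounded n k)).
Qed.

(** The required left continuity of [backward_rhs] follows from that of the three transition
    probabilities in it. *)
Lemma is_derive_trans_prob n k (t : R) : 0 < t ->
  is_derive t 1 (p k n) (backward_rhs n k t).
Proof.
move=> t0; apply: (uniform_right_derivative_is_derive (@cvg_backward_err k)
  (@backward_step n k) t0).
apply: cvgB; first apply: cvgD.
all: by apply: cvgM; [exact: cvg_cst|exact: trans_prob_cvg_left].
Qed.

(** Half of [sigma] is the mean of the two exit rates; the shift by it leaves the diagonal entries
    [gamma] at even and [- gamma] at odd states. *)
Let sigma := a1 + a2 + b1 + b2.
Let gamma := (b1 + b2 - a1 - a2) / 2.

Local Notation diag := (alternate gamma (- gamma)).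

(* n is the target state and k the initial one: the system is in k. *)
Definition scaled_prob (n k : int) (t : R) : R := expR (sigma / 2 * t) * p k n t.

Lemma is_derive_scaled_prob n k (t : R) : 0 < t ->
  is_derive t 1 (scaled_prob n k)
    (tridiag diag up down (fun i => scaled_prob n i t) k).
Proof.
move=> t0; have Dp := is_derive_trans_prob n k t0.
have Dlin : is_derive t 1 (fun s : R => sigma / 2 * s) (sigma / 2).
  apply: (@is_derive_eq _ _ _ ((sigma / 2) \*: id)).
  by rewrite [_ *: _]mulr1.
have De := is_derive1_comp (is_derive_expR (sigma / 2 * t)) Dlin.
apply: (is_derive_eq (is_deriveM De Dp)).
rewrite /backward_rhs /tridiag /scaled_prob /GRing.scale/= /sigma /gamma.
by rewrite /alternate; case: ifP => _; field.
Qed.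

Lemma scaled_prob_series n k t : 0 <= t ->
  (fun N => taylor_sum (fun m => iter m (tridiag diag up down) (point_mass R n) k)
    N t) @ \oo --> scaled_prob n k t.
Proof.
(* The interval [0, t + 1] is nondegenerate even when t = 0. *)
move=> t0; have t1 : 0 < t + 1 by rewrite ltr_wpDl.
have tT : t \in `[0, t + 1]%R by rewrite in_itv/= t0 lerDl ler01.
pose C := `|gamma| + `|a1| + `|a2| + `|b1| + `|b2|.
have -> : point_mass R n = scaled_prob n ^~ 0.
  apply/funext => i; rewrite /scaled_prob mulr0 expR0 mul1r.
  by rewrite (initial_law mcX).
apply: (@tridiag_series _ _ _ _ C _ (scaled_prob n) (t + 1)
  (expR (`|sigma / 2| * (t + 1)))) => //.
- move=> i; rewrite /C /alternate.
  have := (normr_ge0 a1, normr_ge0 a2, normr_ge0 b1, normr_ge0 b2).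
  by move=> [[[? ?] ?] ?]; case: ifP => _; rewrite ?normrN; lra.
- move=> i; apply/continuous_within_itvP => //.
  have cE : continuous (fun s : R => expR (sigma / 2 * s)).
    move=> s; apply: continuous_comp; last exact: continuous_expR.
    by apply: cvgM; [exact: cvg_cst|exact: cvg_id].
  split.
  + move=> s; rewrite in_itv/= => /andP[s0 _]; apply: differentiable_continuous.
    by apply/derivable1_diffP; have [] := is_derive_scaled_prob n i s0.
  + apply: cvgM; first by apply: cvg_at_right_filter; exact: cE.
    exact: trans_prob_cvg_right.
  + apply: cvgM; first by apply: cvg_at_left_filter; exact: cE.
    exact: trans_prob_cvg_left.
- by move=> i s; rewrite in_itv/= => /andP[s0 _]; exact: is_derive_scaled_prob.
- move=> i s; rewrite in_itv/= => /andP[s0 sT]; rewrite /scaled_prob.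
  rewrite normrM -[leRHS]mulr1 ler_pM//.
    rewrite ger0_norm ?expR_ge0// ler_expR; apply: le_trans (ler_norm _) _.
    by rewrite normrM ler_wpM2l// ger0_norm.
  by rewrite ger0_norm ?trans_prob_ge0// (trans_prob_le1 mcX).
Qed.

End BackwardEquation.

(** * Series for the transition probabilities *)

Section NonnegativeSeries.
Variable R : realType.
Implicit Types u v : nat -> R.

Lemma sums_to_eq (N : nat) u v (S : R) : (forall n, u n = v n) ->
  (forall n, (n < N)%N -> v n = 0) ->
  (fun M => \sum_(0 <= n < M) v n) @ \oo --> S -> sums_to N u S.
Proof.
move=> uv v0; rewrite /sums_to.
have -> // : (fun M => \sum_(N <= n < M) u n) = (fun M => \sum_(0 <= n < M) v n).
apply/funext => M; under eq_bigr do rewrite uv.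
have z K : (K <= N)%N -> \sum_(0 <= n < K) v n = 0.
  by move=> KN; rewrite big_nat big1// => i /andP[_ iK]; rewrite v0// (leq_trans iK).
have [NM|MN] := leqP N M; first by rewrite [RHS](@big_cat_nat _ _ _ N)//= z// add0r.
by rewrite big_geq ?z// ltnW.
Qed.

(** The partial sums of [u1] and [u2] are nondecreasing and bounded by L / x and L / y, so each
    series converges separately. *)
Lemma split_nonneg_series u1 u2 (x y L : R) :
  (forall n, 0 <= u1 n) -> (forall n, 0 <= u2 n) -> 0 < x -> 0 < y ->
  (fun M => \sum_(0 <= n < M) (x * u1 n + y * u2 n)) @ \oo --> L ->
  exists S1 S2, [/\ (fun M => \sum_(0 <= n < M) u1 n) @ \oo --> S1,
    (fun M => \sum_(0 <= n < M) u2 n) @ \oo --> S2 & L = x * S1 + y * S2].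
Proof.
move=> u10 u20 x0 y0 cL.
have splitE M : \sum_(0 <= n < M) (x * u1 n + y * u2 n) =
    x * (\sum_(0 <= n < M) u1 n) + y * (\sum_(0 <= n < M) u2 n).
  by rewrite big_split/= !mulr_sumr.
have leL M : \sum_(0 <= n < M) (x * u1 n + y * u2 n) <= L.
  rewrite -(cvg_lim _ cL)//; apply: (nondecreasing_cvgn_le (u_ :=
    fun M => \sum_(0 <= n < M) (x * u1 n + y * u2 n))).
    by apply: nondecreasing_series => n _ _; rewrite addr_ge0// mulr_ge0// ltW.
  by apply/cvg_ex; exists L.
have c1 : cvgn (fun M => \sum_(0 <= n < M) u1 n).
  apply: nondecreasing_is_cvgn; first by apply: nondecreasing_series => n _ _.
  exists (L / x) => _ [M _ <-]; rewrite /= ler_pdivlMr// mulrC.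
  by have := leL M; rewrite splitE; apply: le_trans; rewrite lerDl mulr_ge0 ?(ltW y0)// sumr_ge0.
have c2 : cvgn (fun M => \sum_(0 <= n < M) u2 n).
  apply: nondecreasing_is_cvgn; first by apply: nondecreasing_series => n _ _.
  exists (L / y) => _ [M _ <-]; rewrite /= ler_pdivlMr// mulrC.
  by have := leL M; rewrite splitE; apply: le_trans; rewrite lerDr mulr_ge0 ?(ltW x0)// sumr_ge0.
move: c1 c2 => /cvg_ex[S1 c1] /cvg_ex[S2 c2]; exists S1, S2; split=> //.
have H : (fun M => \sum_(0 <= n < M) (x * u1 n + y * u2 n)) @ \oo -->
    x * S1 + y * S2.
  rewrite (funext splitE).
  by apply: cvgD; apply: cvgM => //; exact: cvg_cst.
by rewrite -(cvg_lim _ cL)// (cvg_lim _ H).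
Qed.

End NonnegativeSeries.

(** The two factors of [step_poly] commute, so one family of coefficients serves the formulas with
    exchanged rates as well. *)
Lemma step_coefC (R : realType) (a1 a2 b1 b2 D : R) n j :
  step_coef b1 b2 a1 a2 D n j = step_coef a1 a2 b1 b2 D n j.
Proof. by rewrite /step_coef /step_poly mulrC. Qed.

Section TransitionSeries.
Variables (R : realType) (d : measure_display) (T : measurableType d).
Variables (P : int -> probability T R) (X : R -> T -> int).
Hypothesis mcX : markov_chain P X.
Variables (a1 a2 b1 b2 : R).
Hypotheses (a1_gt0 : 0 < a1) (a2_gt0 : 0 < a2) (b1_gt0 : 0 < b1) (b2_gt0 : 0 < b2).
Hypothesis genX :
  has_generator (trans_prob P X) (alternating_generator a1 a2 b1 b2).

Local Notation p := (trans_prob P X).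
Let sigma := a1 + a2 + b1 + b2.
Let gamma := (b1 + b2 - a1 - a2) / 2.
Local Notation coef := (step_coef a1 a2 b1 b2 (gamma ^+ 2)).
Local Notation even_term t n := (t ^+ (2 * n)%N / ((2 * n)%N`!)%:R).
Local Notation odd_term t n := (t ^+ (2 * n + 1)%N / ((2 * n + 1)%N`!)%:R).

Lemma scaled_prob_double k x t : 0 <= t ->
  (fun M => \sum_(0 <= n < M)
    (even_term t n * iter (2 * n) (tridiag (alternate gamma (- gamma))
       (alternate a1 b1) (alternate a2 b2)) (point_mass R x) k +
     odd_term t n * iter (2 * n + 1) (tridiag (alternate gamma (- gamma))
       (alternate a1 b1) (alternate a2 b2)) (point_mass R x) k)) @ \oo -->
  scaled_prob P X a1 a2 b1 b2 x k t.
Proof.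
move=> t0; have H := @scaled_prob_series _ _ _ _ _ mcX _ _ _ _ genX x k t t0.
rewrite -(funext (fun M => taylor_sum_double (fun m => iter m (tridiag _ _ _)
  (point_mass R x) k) M t)).
(* The partial sums over pairs of terms are the even-indexed subsequence of the Taylor sums. *)
apply: cvg_comp H => A [N _ NA]; exists N => // n /= Nn; apply: NA => /=.
by rewrite (leq_trans Nn)// mul2n -addnn leq_addr.
Qed.

Lemma trans_probE k x t :
  p k x t = expR (- (sigma / 2) * t) * scaled_prob P X a1 a2 b1 b2 x k t.
Proof. by rewrite /scaled_prob mulrA -expRD mulNr addNr expR0 mul1r. Qed.

Lemma same_parity_series x j t : 0 <= t ->
  (fun M => \sum_(0 <= n < M)
    (even_term t n + odd_term t n * alternate gamma (- gamma) x) * coef n j) @ \oo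
  --> scaled_prob P X a1 a2 b1 b2 x (x - 2 * j) t.
Proof.
move=> t0; have := @scaled_prob_double (x - 2 * j) x t t0.
apply: cvg_trans; apply: near_eq_cvg; apply: nearW => M; apply: eq_bigr => n _.
by rewrite iter_tridiag_even iter_tridiag_odd_diag; ring.
Qed.

Lemma coef_ge0 n j : 0 <= coef n j.
Proof. by rewrite step_coef_ge0// ?sqr_ge0// ltW. Qed.

(** Only odd powers of t survive, each with two nonnegative coefficients weighted by positive rates,
    so the series can be split. *)
Lemma opposite_parity_series x j t : 0 <= t ->
  exists S1 S2, [/\ (fun M => \sum_(0 <= n < M) odd_term t n * coef n j) @ \oo --> S1,
    (fun M => \sum_(0 <= n < M) odd_term t n * coef n (j + 1)) @ \oo --> S2 &
    scaled_prob P X a1 a2 b1 b2 x (x - 2 * j - 1) t =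
    alternate b1 a1 x * S1 + alternate b2 a2 x * S2].
Proof.
move=> t0.
have odd0 n : 0 <= odd_term t n by rewrite divr_ge0 ?exprn_ge0.
apply: split_nonneg_series.
- by move=> n; rewrite mulr_ge0 ?coef_ge0.
- by move=> n; rewrite mulr_ge0 ?coef_ge0.
- by rewrite /alternate; case: ifP.
- by rewrite /alternate; case: ifP.
have := @scaled_prob_double (x - 2 * j - 1) x t t0.
apply: cvg_trans; apply: near_eq_cvg; apply: nearW => M; apply: eq_bigr => n _.
by rewrite iter_tridiag_even0 iter_tridiag_odd; ring.
Qed.

End TransitionSeries.

(** * The transition probabilities by parity of the two states *)

Theorem propositionA1 (R : realType) (a1 a2 b1 b2 : R)
    (a1_gt0 : 0 < a1) (a2_gt0 : 0 < a2) (b1_gt0 : 0 < b1) (b2_gt0 : 0 < b2)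
    (d : measure_display) (T : measurableType d)
    (P : int -> probability T R) (X : R -> T -> int)
    (mcX : markov_chain P X)
    (genX : has_generator (trans_prob P X) (alternating_generator a1 a2 b1 b2)) :
  let p := trans_prob P X in
  let sigma := a1 + a2 + b1 + b2 in
  let delta := b1 + b2 - a1 - a2 in
  let rho := a1 * b1 / (a2 * b2) in
  (a1 + a2 <> b1 + b2 ->
   forall (s r : int) (t : R), 0 <= t ->
   [/\ exists2 S : R,
         sums_to (absz (s - r)%R) (fun n =>
           rho ^ (s - r) *
           (t ^+ (2 * n) / ((2 * n)`!)%:R * (delta / 2) ^+ (2 * n) +
            t ^+ (2 * n + 1) / ((2 * n + 1)`!)%:R *
              (delta / 2) ^+ (2 * n + 1)) *
           theta_coef a1 a2 b1 b2 n r s) S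
         & p (2 * r) (2 * s) t = expR (- (sigma / 2) * t) * S,
       exists S1 S2 : R,
         [/\ sums_to (absz (s - r)%R) (fun n =>
               t ^+ (2 * n + 1) / ((2 * n + 1)`!)%:R * (delta / 2) ^+ (2 * n) *
               rho ^ (s - r) * theta_coef a1 a2 b1 b2 n r s) S1,
             sums_to (absz (s - r + 1)%R) (fun n =>
               t ^+ (2 * n + 1) / ((2 * n + 1)`!)%:R * (delta / 2) ^+ (2 * n) *
               rho ^ (s - r + 1) * theta_coef a1 a2 b1 b2 n r (s + 1)) S2
           & p (2 * r) (2 * s + 1) t =
               expR (- (sigma / 2) * t) * (a1 * S1 + a2 * S2)],
       exists S1 S2 : R,
         [/\ sums_to (absz (s - r)%R) (fun n =>
               t ^+ (2 * n + 1) / ((2 * n + 1)`!)%:R * (delta / 2) ^+ (2 * n) *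
               rho ^ (s - r) * theta_coef b1 b2 a1 a2 n r s) S1,
             sums_to (absz (s - r - 1)%R) (fun n =>
               t ^+ (2 * n + 1) / ((2 * n + 1)`!)%:R * (delta / 2) ^+ (2 * n) *
               rho ^ (s - r - 1) * theta_coef b1 b2 a1 a2 n r (s - 1)) S2
           & p (2 * r + 1) (2 * s) t =
               expR (- (sigma / 2) * t) * (b2 * S1 + b1 * S2)]
     & exists2 S : R,
         sums_to (absz (s - r)%R) (fun n =>
           rho ^ (s - r) *
           (t ^+ (2 * n) / ((2 * n)`!)%:R * (delta / 2) ^+ (2 * n) +
            t ^+ (2 * n + 1) / ((2 * n + 1)`!)%:R *
              (- delta / 2) ^+ (2 * n + 1)) *
           theta_coef b1 b2 a1 a2 n r s) S
         & p (2 * r + 1) (2 * s + 1) t = expR (- (sigma / 2) * t) * S])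
  /\
  (a1 + a2 = b1 + b2 ->
   forall (s r : int) (t : R), 0 <= t ->
   [/\ exists2 S : R,
         sums_to (absz (s - r)%R) (fun n =>
           rho ^ (s - r) * (t ^+ (2 * n) / ((2 * n)`!)%:R) *
           eta_coef a1 a2 b1 b2 n r s) S
         & p (2 * r) (2 * s) t = expR (- (a1 + a2) * t) * S,
       exists S1 S2 : R,
         [/\ sums_to (absz (s - r)%R) (fun n =>
               t ^+ (2 * n + 1) / ((2 * n + 1)`!)%:R *
               rho ^ (s - r) * eta_coef a1 a2 b1 b2 n r s) S1,
             sums_to (absz (s - r + 1)%R) (fun n =>
               t ^+ (2 * n + 1) / ((2 * n + 1)`!)%:R *
               rho ^ (s - r + 1) * eta_coef a1 a2 b1 b2 n r (s + 1)) S2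
           & p (2 * r) (2 * s + 1) t =
               expR (- (a1 + a2) * t) * (a1 * S1 + a2 * S2)],
       exists S1 S2 : R,
         [/\ sums_to (absz (s - r)%R) (fun n =>
               t ^+ (2 * n + 1) / ((2 * n + 1)`!)%:R *
               rho ^ (s - r) * eta_coef b1 b2 a1 a2 n r s) S1,
             sums_to (absz (s - r - 1)%R) (fun n =>
               t ^+ (2 * n + 1) / ((2 * n + 1)`!)%:R *
               rho ^ (s - r - 1) * eta_coef b1 b2 a1 a2 n r (s - 1)) S2
           & p (2 * r + 1) (2 * s) t =
               expR (- (a1 + a2) * t) * (b2 * S1 + b1 * S2)]
     & exists2 S : R,
         sums_to (absz (s - r)%R) (fun n =>
           t ^+ (2 * n) / ((2 * n)`!)%:R * rho ^ (s - r) *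
           eta_coef b1 b2 a1 a2 n r s) S
         & p (2 * r + 1) (2 * s + 1) t = expR (- (a1 + a2) * t) * S]).
Proof.
move=> p sigma delta rho.
have a1n0 : a1 != 0 by rewrite gt_eqF.
have a2n0 : a2 != 0 by rewrite gt_eqF.
have b1n0 : b1 != 0 by rewrite gt_eqF.
have b2n0 : b2 != 0 by rewrite gt_eqF.
have rhoC : rho = b1 * a1 / (b2 * a2).
  by rewrite /rho (mulrC b1) (mulrC b2).
pose g := delta / 2.
pose c n j := step_coef a1 a2 b1 b2 (g ^+ 2) n j.
have c0 n j N : (n < N)%N -> `|j|%N = N -> c n j = 0.
  by move=> nN jN; rewrite /c step_coef_eq0// jN.
pose ev (t : R) (n : nat) := t ^+ (2 * n) / ((2 * n)`!)%:R.
pose od (t : R) (n : nat) := t ^+ (2 * n + 1) / ((2 * n + 1)`!)%:R.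
pose Q k x t := scaled_prob P X a1 a2 b1 b2 x k t.
have pE k x t : p k x t = expR (- (sigma / 2) * t) * Q k x t.
  exact: trans_probE.
have even_even s r t : 0 <= t ->
    (fun M => \sum_(0 <= n < M) (ev t n + od t n * g) * c n (s - r)) @ \oo -->
    Q (2 * r) (2 * s) t.
  move=> t0; have := @same_parity_series _ _ _ _ _ mcX _ _ _ _ genX (2 * s) (s - r) t t0.
  by rewrite alternate_even (_ : 2 * s - 2 * (s - r) = 2 * r)//; ring.
have odd_odd s r t : 0 <= t ->
    (fun M => \sum_(0 <= n < M) (ev t n + od t n * - g) * c n (s - r)) @ \oo -->
    Q (2 * r + 1) (2 * s + 1) t.
  move=> t0; have := @same_parity_series _ _ _ _ _ mcX _ _ _ _ genX (2 * s + 1) (s - r) t t0.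
  by rewrite alternate_odd (_ : 2 * s + 1 - 2 * (s - r) = 2 * r + 1)//; ring.
have even_odd s r t : 0 <= t -> exists S1 S2,
    [/\ (fun M => \sum_(0 <= n < M) od t n * c n (s - r)) @ \oo --> S1,
        (fun M => \sum_(0 <= n < M) od t n * c n (s - r + 1)) @ \oo --> S2 &
        Q (2 * r) (2 * s + 1) t = a1 * S1 + a2 * S2].
  move=> t0; have := @opposite_parity_series _ _ _ _ _ mcX _ _ _ _ a1_gt0 a2_gt0
    b1_gt0 b2_gt0 genX (2 * s + 1) (s - r) t t0.
  by rewrite !alternate_odd (_ : 2 * s + 1 - 2 * (s - r) - 1 = 2 * r)//; ring.
have odd_even s r t : 0 <= t -> exists S1 S2,
    [/\ (fun M => \sum_(0 <= n < M) od t n * c n (s - r)) @ \oo --> S1,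
        (fun M => \sum_(0 <= n < M) od t n * c n (s - r - 1)) @ \oo --> S2 &
        Q (2 * r + 1) (2 * s) t = b2 * S1 + b1 * S2].
  (* With j = s - r - 1 the starting state 2s - 2j - 1 is 2r + 1; the two series come in the
     opposite order and are swapped below. *)
  move=> t0; have := @opposite_parity_series _ _ _ _ _ mcX _ _ _ _ a1_gt0 a2_gt0
    b1_gt0 b2_gt0 genX (2 * s) (s - r - 1) t t0.
  rewrite !alternate_even subrK (_ : 2 * s - 2 * (s - r - 1) - 1 = 2 * r + 1); last by ring.
  by move=> [S1 [S2 [H1 H2 E]]]; exists S2, S1; split=> //; rewrite /Q E addrC.
split=> [ab s r t t0|ab s r t t0].
  have d0 : delta != 0 by apply/eqP => dE; apply: ab; move: dE; rewrite /delta; lra.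
  have thetaE n i j : c n (j - i) = (delta / 2) ^+ (2 * n) * rho ^ (j - i) *
      theta_coef a1 a2 b1 b2 n i j.
    by rewrite (theta_coefE a1n0 a2n0 b1n0 b2n0)// /delta; ring.
  have thetaCE n i j : c n (j - i) = (delta / 2) ^+ (2 * n) * rho ^ (j - i) *
      theta_coef b1 b2 a1 a2 n i j.
    (* Both the coefficients and [rho] are symmetric under the exchange of rates. *)
    by rewrite /c -(step_coefC a1 a2 b1 b2) rhoC (theta_coefE b1n0 b2n0 a1n0 a2n0).
  split.
  - exists (Q (2 * r) (2 * s) t) => //.
    apply: sums_to_eq (even_even s r t t0) => n.
      by rewrite thetaE /ev /od /g [(delta / 2) ^+ (2 * n + 1)]exprD expr1; ring.
    by move=> nN; rewrite (c0 _ _ _ nN)// mulr0.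
  - have [S1 [S2 [H1 H2 E]]] := even_odd s r t t0; exists S1, S2; split.
    + apply: sums_to_eq H1 => n; first by rewrite thetaE /od; ring.
      by move=> nN; rewrite (c0 _ _ _ nN)// mulr0.
    + have jE : s - r + 1 = s + 1 - r by ring.
      apply: sums_to_eq H2 => n; first by rewrite jE thetaE /od; ring.
      by move=> nN; rewrite (c0 _ _ _ nN)// mulr0.
    + by rewrite pE E.
  - have [S1 [S2 [H1 H2 E]]] := odd_even s r t t0; exists S1, S2; split.
    + apply: sums_to_eq H1 => n; first by rewrite thetaCE /od; ring.
      by move=> nN; rewrite (c0 _ _ _ nN)// mulr0.
    + have jE : s - r - 1 = s - 1 - r by ring.
      apply: sums_to_eq H2 => n; first by rewrite jE thetaCE /od; ring.
      by move=> nN; rewrite (c0 _ _ _ nN)// mulr0.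
    + by rewrite pE E.
  - exists (Q (2 * r + 1) (2 * s + 1) t) => //.
    apply: sums_to_eq (odd_odd s r t t0) => n.
      (* The diagonal entry at an odd target is [- g], which accounts for the sign in the odd
         powers. *)
      have -> : (- delta / 2) ^+ (2 * n + 1) = - ((delta / 2) ^+ (2 * n) * (delta / 2)).
        by rewrite mulNr exprD expr1 exprM sqrrN -exprM mulrN.
      by rewrite thetaCE /ev /od /g; ring.
    by move=> nN; rewrite (c0 _ _ _ nN)// mulr0.
(* For equal exit rates the diagonal vanishes: D = 0 in the coefficients, and the odd powers of t
   drop out between states of the same parity. *)
have g0 : g = 0 by rewrite /g /delta (_ : _ - a2 = 0) ?mul0r//; lra.
have sE : a1 + a2 = sigma / 2 by rewrite /sigma; lra.
have etaE n i j : c n (j - i) = rho ^ (j - i) * eta_coef a1 a2 b1 b2 n i j.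
  by rewrite (eta_coefE a1n0 a2n0 b1n0 b2n0) /c g0 expr0n.
have etaCE n i j : c n (j - i) = rho ^ (j - i) * eta_coef b1 b2 a1 a2 n i j.
  by rewrite rhoC (eta_coefE b1n0 b2n0 a1n0 a2n0) step_coefC /c g0 expr0n.
rewrite sE; split.
- exists (Q (2 * r) (2 * s) t) => //.
  apply: sums_to_eq (even_even s r t t0) => n.
    by rewrite etaE g0 /ev; ring.
  by move=> nN; rewrite (c0 _ _ _ nN)// mulr0.
- have [S1 [S2 [H1 H2 E]]] := even_odd s r t t0; exists S1, S2; split.
  + apply: sums_to_eq H1 => n; first by rewrite etaE /od; ring.
    by move=> nN; rewrite (c0 _ _ _ nN)// mulr0.
  + have jE : s - r + 1 = s + 1 - r by ring.
    apply: sums_to_eq H2 => n; first by rewrite jE etaE /od; ring.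
    by move=> nN; rewrite (c0 _ _ _ nN)// mulr0.
  + by rewrite pE E.
- have [S1 [S2 [H1 H2 E]]] := odd_even s r t t0; exists S1, S2; split.
  + apply: sums_to_eq H1 => n; first by rewrite etaCE /od; ring.
    by move=> nN; rewrite (c0 _ _ _ nN)// mulr0.
  + have jE : s - r - 1 = s - 1 - r by ring.
    apply: sums_to_eq H2 => n; first by rewrite jE etaCE /od; ring.
    by move=> nN; rewrite (c0 _ _ _ nN)// mulr0.
  + by rewrite pE E.
- exists (Q (2 * r + 1) (2 * s + 1) t) => //.
  apply: sums_to_eq (odd_odd s r t t0) => n.
    by rewrite etaCE g0 /ev; ring.
  by move=> nN; rewrite (c0 _ _ _ nN)// mulr0.
Qed.
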